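(* Let $\eta\in(0,1)$. Let $\mathcal{A}$ be a streaming algorithm for attention-based token generation that decides before seeing any data which entries of $QK^T$ to access. Suppose that $\mathcal{A}$, with probability at least $9/10$, outputs for each $i\in[n]$ a $(1\pm\eta)$-approximation $\mathcal{O}_i\in\mathbb{R}^d$ of $Z_i := \operatorname{Attn}(q_i,K_i,V_i)$. Then $\mathcal{A}$ must take $\Omega(nd)$ time to process the last token $(q_n,k_n,v_n)$ in the worst case.
   Context: Setting (attention-based token generation): the input is a stream of $n$ triples $(q_i,k_i,v_i)\in(\mathbb{R}^d)^3$ arriving one at a time; the guarantee of a streaming algorithm must hold for every input stream, the probability being over its own randomness. For each $i$, $K_i$ and $V_i$ are the $i\times d$ matrices whose rows are $k_1^T,\dots,k_i^T$ and $v_1^T,\dots,v_i^T$ respectively; $Q$ and $K$ are the $n\times d$ matrices with rows $q_1^T,\dots,q_n^T$ and $k_1^T,\dots,k_n^T$, so that the $(i,\ell)$ entry of $QK^T$ is the score $q_i^Tk_\ell$. The attention function is $\operatorname{Attn}(q_i,K_i,V_i) := \sum_{\ell=1}^i \frac{e^{q_i^Tk_\ell}}{\sum_{m=1}^i e^{q_i^Tk_m}}\, v_\ell\in\mathbb{R}^d$. A vector $x\in\mathbb{R}^d$ is a $(1\pm\eta)$-approximation of $y\in\mathbb{R}^d$ if $|x_j-y_j|\le\eta\cdot y_j$ for all $j\in[d]$. Non-adaptivity: an algorithm is non-adaptive if the data accesses/queries it performs are pre-decided (either deterministically or through a randomized procedure) before the data arrives. Computational model: when processing the last token, the algorithm is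 viewed as making queries to the softmax distribution $D_n$ over $[n]$ with scores $q_n^Tk_1,\dots,q_n^Tk_n$ (so that $\operatorname{Attn}(q_n,K_n,V_n)=\mathbb{E}_{\ell\sim D_n}[v_\ell]$); each query to an index $\ell$ (access to the entry $q_n^Tk_\ell$) takes time $\Theta(d)$. *)

(* Defs.v *)
From HB Require Import structures.
From mathcomp Require Import all_boot all_order all_algebra.
From mathcomp Require Import all_classical all_reals all_analysis.

Set Implicit Arguments.
Unset Strict Implicit.
Unset Printing Implicit Defensive.

Import Order.TTheory GRing.Theory Num.Theory.
Local Open Scope classical_set_scope.
Local Open Scope ring_scope.

(* Vectors of R^d are rows. A stream has n.+1 tokens, indexed
   by 'I_n.+1; token i is the (i+1)-st one and ord_max is the last one. *)

Record stream (R : realType) (n d : nat) := Stream {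
  queries : 'M[R]_(n.+1, d);
  keys : 'M[R]_(n.+1, d);
  values : 'M[R]_(n.+1, d) }.

Definition scores (R : realType) (n d : nat) (s : stream R n d) :
    'M[R]_(n.+1) :=
  queries s *m (keys s)^T.

Definition Attn (R : realType) (d m : nat) (q : 'rV[R]_d) (K V : 'M[R]_(m, d)) :
    'rV[R]_d :=
  \sum_(l < m)
    (expR ((q *m K^T) 0 l) / \sum_(p < m) expR ((q *m K^T) 0 p)) *: row l V.

(* The matrix of the tokens 0, ..., i. *)
Definition prefix_mx (R : realType) (n d : nat) (i : 'I_n.+1)
    (M : 'M[R]_(n.+1, d)) : 'M[R]_(i.+1, d) :=
  rowsub (widen_ord (ltn_ord i)) M.

Definition target (R : realType) (n d : nat) (s : stream R n d) (i : 'I_n.+1) :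
    'rV[R]_d :=
  Attn (row i (queries s)) (prefix_mx i (keys s)) (prefix_mx i (values s)).

Definition approximates (R : realType) (d : nat) (eta : R) (x y : 'rV[R]_d) :=
  forall j : 'I_d, `|x 0 j - y 0 j| <= eta * y 0 j.

(* What the algorithm may have seen of the stream when it answers token i, if
   E is the set of entries of Q K^T that it accesses: the incoming triple, the
   earlier queries and values, and the entries of E available at that time.
   Earlier keys are visible only through accessed scores. *)
Definition same_view (R : realType) (n d : nat) (E : {set 'I_n.+1 * 'I_n.+1})
    (i : 'I_n.+1) (s s' : stream R n d) : Prop :=
  [/\ row i (keys s) = row i (keys s'),
      forall l : 'I_n.+1, (l <= i)%N ->
        row l (queries s) = row l (queries s') /\
        row l (values s) = row l (values s')
    & forall a b : 'I_n.+1, (a <= i)%N -> (b <= i)%N -> (a, b) \in E ->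
        scores s a b = scores s' a b].

(* Omega is the space of the random coins. Non-adaptivity is the fact that
   accesses does not take the stream as an argument. *)
Record nonadaptive_algorithm (R : realType) (n d : nat) (disp : measure_display)
    (Omega : measurableType disp) := NonadaptiveAlgorithm {
  accesses : Omega -> {set 'I_n.+1 * 'I_n.+1};
  output : Omega -> stream R n d -> 'I_n.+1 -> 'rV[R]_d;
  output_view : forall w i s s',
    same_view (accesses w) i s s' -> output w s i = output w s' i;
  measurable_accesses : forall a b,
    measurable [set w | (a, b) \in accesses w];
  measurable_output : forall s i j,
    measurable_fun setT (fun w => output w s i 0 j);
  (* time of the query to the score of index l, for the last token *)
  query_time : Omega -> stream R n d -> 'I_n.+1 -> R;
  (* time spent on the last token outside these queries *)
  other_time : Omega -> stream R n d -> R;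
  other_time_ge0 : forall w s, 0 <= other_time w s }.

(* The indices at which the softmax distribution of the last token is queried. *)
Definition last_queries (R : realType) (n d : nat) (disp : measure_display)
    (Omega : measurableType disp) (A : nonadaptive_algorithm R n d Omega)
    (w : Omega) : {set 'I_n.+1} :=
  [set l | (ord_max, l) \in accesses A w]%SET.

Definition last_token_time (R : realType) (n d : nat) (disp : measure_display)
    (Omega : measurableType disp) (A : nonadaptive_algorithm R n d Omega)
    (w : Omega) (s : stream R n d) : R :=
  \sum_(l in last_queries A w) query_time A w s l + other_time A w s.

(* A query takes time Theta(d), with constants c1 and c2. *)
Definition query_time_Theta (R : realType) (n d : nat) (disp : measure_display)
    (Omega : measurableType disp) (c1 c2 : R)
    (A : nonadaptive_algorithm R n d Omega) : Prop :=
  forall w s l, c1 * d%:R <= query_time A w s l <= c2 * d%:R.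

Definition success (R : realType) (n d : nat) (disp : measure_display)
    (Omega : measurableType disp) (eta : R)
    (A : nonadaptive_algorithm R n d Omega) (s : stream R n d) : set Omega :=
  [set w | forall i, approximates eta (output A w s i) (target s i)].

(* The streams range over those with nonnegative values: a vector with a
   negative coordinate has no (1 +- eta)-approximation, so no algorithm meets
   the guarantee on a stream where some attention vector has one. *)
Definition correct (R : realType) (n d : nat) (disp : measure_display)
    (Omega : measurableType disp) (P : probability Omega R) (eta : R)
    (A : nonadaptive_algorithm R n d Omega) : Prop :=
  forall s : stream R n d, (forall l j, 0 <= values s l j) ->
    ((9 / 10)%:E <= P (success eta A s))%E.

(* Worst case over the streams and the coins. Coins in a negligible set do not
   count, so that the lower bound also applies to almost sure time bounds. *)
Definition worst_case_time_ge (R : realType) (n d : nat)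
    (disp : measure_display) (Omega : measurableType disp)
    (P : probability Omega R) (A : nonadaptive_algorithm R n d Omega) (T : R) :
    Prop :=
  exists s : stream R n d,
    ~ P.-negligible [set w | T <= last_token_time A w s].

(* Main.v *)
(* Fix l different from the last index n, and hide the only nonzero value in
   token l: the values are 1 at (l, j) and 0 elsewhere, the queries vanish except
   that q_n is the basis vector e_j, and the keys vanish except k_l = t e_j. The
   only score that depends on t is the one at (n, l), so an algorithm that does
   not access it gives the same last answer for all t, whereas the attention
   e^t / (n + e^t) at coordinate j tends to 0 when t tends to -oo. No answer is a
   (1 +- eta)-approximation both for t = 0 and for e^t = (1 - eta) / 8. Both
   streams are answered correctly with probability at least 8/10, hence l is
   queried with probability at least 4/5. By linearity of expectation, at least
   4 n / 5 indices are queried on average, which is impossible if almost surely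
   fewer than (n + 1) / 5 of them are. *)

Require Import Defs.
From HB Require Import structures.
From mathcomp Require Import all_boot all_order all_algebra.
From mathcomp Require Import all_classical all_reals all_analysis.
From mathcomp Require Import measurable_realfun ring lra.

Set Implicit Arguments.
Unset Strict Implicit.
Unset Printing Implicit Defensive.

Import Order.TTheory GRing.Theory Num.Theory.
Local Open Scope ring_scope.

(** Linearity of expectation: integrating a pointwise bound between indicators bounds the
    probabilities, with no independence assumed. *)
Lemma sum_probability_le (R : realType) (disp : measure_display)
    (T : measurableType disp) (P : probability T R) (I : finType)
    (F : I -> set T) (B : set T) (a b : R) :
  0 <= a -> 0 <= b -> (forall i, measurable (F i)) -> measurable B ->
  (forall w, \sum_i \1_(F i) w <= a + b * \1_B w) ->
  (\sum_i P (F i) <= a%:E + b%:E * P B)%E.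
Proof.
move=> a0 b0 mF mB leFB.
have -> : (\sum_i P (F i) = \int[P]_w (\sum_i (\1_(F i) w)%:E)%E)%E.
  rewrite ge0_integral_sum//.
  - by apply: eq_bigr => i _; rewrite integral_indic// setIT.
  - by move=> i; apply/measurable_EFinP; apply: measurable_indic.
have -> : (a%:E + b%:E * P B = \int[P]_w (a%:E + b%:E * (\1_B w)%:E)%E)%E.
  have mB1 : measurable_fun setT (fun w => (\1_B w : R)%:E).
    by apply/measurable_EFinP; apply: measurable_indic.
  rewrite ge0_integralD//.
  - rewrite integral_cst//= probability_setT mule1.
    by rewrite ge0_integralZl// ?lee_fin// integral_indic// setIT.
  - by move=> w _; rewrite mule_ge0// lee_fin.
  - exact: measurable_funeM.
apply: ge0_le_integral => //.
- by move=> w _; rewrite sume_ge0// => i _; rewrite lee_fin.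
- apply: emeasurable_sum => i; apply/measurable_EFinP.
  exact: measurable_indic.
- apply: emeasurable_funD => //; apply: measurable_funeM.
  by apply/measurable_EFinP; apply: measurable_indic.
- by move=> w _; rewrite sumEFin -EFinM -EFinD lee_fin.
Qed.

Lemma measurable_success (R : realType) (n d : nat) (disp : measure_display)
    (Omega : measurableType disp) (eta : R) (A : nonadaptive_algorithm R n d Omega)
    (s : stream R n d) : measurable (success eta A s).
Proof.
have -> : success eta A s =
    (\bigcap_i \bigcap_j [set w | `|output A w s i 0 j - target s i 0 j| <=
                                  eta * target s i 0 j])%classic.
  apply/seteqP; split=> w /= h; first by move=> i _ j _; apply: h.
  by move=> i j; apply: h.
apply: fin_bigcap_measurable => [|i _]; first exact: finite_finset.
apply: fin_bigcap_measurable => [|j _]; first exact: finite_finset.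
rewrite (_ : mkset _ = (fun w => output A w s i 0 j) @^-1`
  `[target s i 0 j - eta * target s i 0 j,
    target s i 0 j + eta * target s i 0 j])%classic; last first.
  by apply/seteqP; split=> w /=; rewrite in_itv/= ler_distl.
rewrite -[X in measurable X]setTI.
by apply: measurable_output.
Qed.

Definition spike_stream (R : realType) (n d : nat) (l : 'I_n.+1) (j : 'I_d)
    (t : R) : stream R n d :=
  Stream (delta_mx ord_max j) (t *: delta_mx l j) (delta_mx l j).

Lemma scores_spike (R : realType) (n d : nat) (l : 'I_n.+1) (j : 'I_d) (t : R) :
  scores (spike_stream l j t) = t *: delta_mx ord_max l.
Proof. by rewrite /scores/= linearZ/= trmx_delta -scalemxAr mul_delta_mx. Qed.

Lemma prefix_mx_max (R : realType) (n d : nat) (M : 'M[R]_(n.+1, d)) :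
  prefix_mx ord_max M = M.
Proof.
by apply/matrixP => a b; rewrite mxE; congr (M _ _); apply: val_inj.
Qed.

Lemma target_spike (R : realType) (n d : nat) (l : 'I_n.+1) (j : 'I_d) (t : R) :
  target (spike_stream l j t) ord_max 0 j = expR t / (n%:R + expR t).
Proof.
rewrite /target !prefix_mx_max /Attn -row_mul.
rewrite -[queries _ *m _]/(scores _) scores_spike /=.
have sE (p : 'I_n.+1) : row ord_max (t *: delta_mx ord_max l) 0 p = t * (p == l)%:R.
  by rewrite !mxE eqxx.
rewrite summxE (bigD1 l)//= [X in _ + X]big1 ?addr0 => [|p /negbTE pl]; last first.
  by rewrite !mxE pl mulr0.
rewrite mxE !sE eqxx mulr1 !mxE !eqxx mulr1; congr (_ / _).
(* The [n] indices other than [l] have score 0, hence weight 1 each. *)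
rewrite (bigD1 l)//= sE eqxx mulr1 addrC; congr (_ + _).
rewrite (eq_bigr (fun=> 1)) => [|p /negbTE pl]; last first.
  by rewrite sE pl mulr0 expR0.
by rewrite sumr_const cardC1 card_ord.
Qed.

(** The view includes the incoming key; as [l] is not the last index, that key is 0 in both
    streams. *)
Lemma same_view_spike (R : realType) (n d : nat) (E : {set 'I_n.+1 * 'I_n.+1})
    (l : 'I_n.+1) (j : 'I_d) (t t' : R) :
  l != ord_max -> (ord_max, l) \notin E ->
  same_view E ord_max (spike_stream l j t) (spike_stream l j t').
Proof.
move=> lmax lE; split=> [|//|a b _ _ abE].
  by apply/rowP => k; rewrite !mxE eq_sym (negbTE lmax) !mulr0.
rewrite !scores_spike !mxE.
have [/eqP a_max|] := boolP (a == ord_max); last by rewrite !mulr0.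
have [/eqP bl|] := boolP (b == l); last by rewrite !mulr0.
by move: lE; rewrite -a_max -bl abE.
Qed.

(** Together the bounds give [(1 - eta) * y <= (1 + eta) * y']. The factor [1 - eta] in [u] cancels,
    leaving [N + u <= (1 + eta) / 8 * (N + 1)], whose right side is below [N / 2] since
    [eta < 1 <= N]. *)
Lemma spike_targets_separated (R : realType) (n : nat) (eta x : R) :
  (0 < n)%N -> 0 < eta < 1 ->
  let y := expR 0 / (n%:R + expR 0) in
  let u := expR (ln ((1 - eta) / 8)) in
  let y' := u / (n%:R + u) in
  `|x - y| <= eta * y -> `|x - y'| <= eta * y' -> False.
Proof.
move=> n0 /andP[eta0 eta1] /=.
have nR : 1 <= n%:R :> R by rewrite ler1n.
rewrite expR0 lnK ?posrE; last by lra.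
set N : R := n%:R in nR *; set u : R := _ / 8.
have u0 : 0 < u by rewrite /u; lra.
rewrite !ler_distl => /andP[h1 _] /andP[_ h2].
have : (1 - eta) * (1 / (N + 1)) <= (1 + eta) * (u / (N + u)) by lra.
rewrite !mulrA ler_pdivrMr; last by lra.
rewrite mulrAC ler_pdivlMr; last by lra.
have gap : 0 < (1 - eta) * (N + u - (1 + eta) / 8 * (N + 1)).
  by rewrite mulr_gt0 ?subr_gt0//; nra.
by apply/negP; rewrite -ltNge; lra.
Qed.

Lemma probability_last_query_ge (R : realType) (n d : nat)
    (disp : measure_display) (Omega : measurableType disp)
    (P : probability Omega R) (eta : R) (A : nonadaptive_algorithm R n d Omega)
    (l : 'I_n.+1) :
  0 < eta < 1 -> (0 < d)%N -> correct P eta A -> l != ord_max ->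
  ((4 / 5)%:E <= P [set w | (ord_max, l) \in accesses A w]%classic)%E.
Proof.
move=> eta01 d0 cA lmax.
have n0 : (0 < n)%N.
  by case: n l lmax {A cA} => // l; rewrite (ord1 l) (ord1 ord_max).
pose j := Ordinal d0.
pose s (b : bool) : stream R n d :=
  spike_stream l j (if b then 0 else ln ((1 - eta) / 8)).
have sv b : (forall a k, 0 <= values (s b) a k) by move=> a k; rewrite mxE.
set Al := [set w | _]%classic.
have mAl : measurable Al := measurable_accesses A ord_max l.
(* Both runs can succeed only if [l] is queried, so 9/10 + 9/10 - 1 = 4/5 bounds [P Al] from
   below. *)
have : (\sum_b P (success eta A (s b)) <= 1%:E + 1%:E * P Al)%E.
  apply: sum_probability_le => // [b|w]; first exact: measurable_success.
  have [lw|lw] := boolP ((ord_max, l) \in accesses A w).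
    rewrite big_bool/= (@indicE _ _ Al) mem_set// mul1r.
    by rewrite lerD// indicE lern1 leq_b1.
  have oE : output A w (s true) ord_max = output A w (s false) ord_max.
    by apply: output_view; apply: same_view_spike.
  rewrite big_bool/= (@indicE _ _ Al) memNset; last exact/negP.
  rewrite mulr0 addr0 !indicE -natrD lern1.
  case: (boolP (w \in _)) => [/set_mem st|_]; last by rewrite leq_b1.
  case: (boolP (w \in _)) => [/set_mem sf|//].
  move: (st ord_max j) (sf ord_max j).
  rewrite /s oE !target_spike => h1 h2; exfalso.
  exact: (spike_targets_separated n0 eta01 h1 h2).
rewrite big_bool/= mul1e => h.
have := le_trans (leeD (cA _ (sv true)) (cA _ (sv false))) h.
rewrite -EFinD -(fineK (fin_num_measure P _ mAl)) -EFinD !lee_fin; lra.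
Qed.

Theorem theorem2 (R : realType) (c1 c2 : R) (hc1 : 0 < c1) (hc2 : c1 <= c2) :
  exists (c : R) (N : nat), 0 < c /\
    forall (eta : R) (n d : nat) (disp : measure_display)
      (Omega : measurableType disp) (P : probability Omega R)
      (A : nonadaptive_algorithm R n d Omega),
      0 < eta < 1 -> (N <= n.+1)%N -> (0 < d)%N ->
      query_time_Theta c1 c2 A ->
      correct P eta A ->
      worst_case_time_ge P A (c * n.+1%:R * d%:R).
Proof.
(* Two tokens give [1 <= n], which makes [4 * n / 5] exceed [(n + 1) / 5]. *)
exists (c1 / 5), 2; split=> [|eta n d disp Omega P A eta01 n2 d0 tA cA].
  by rewrite divr_gt0.
(* Any stream would do: the accesses ignore the data, and each query costs at least [c1 * d] on
   every stream. *)
exists (Stream 0 0 0) => Pnegl.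
pose F (l : 'I_n.+1) := [set w | (ord_max, l) \in accesses A w]%classic.
have mF l : measurable (F l) := measurable_accesses A ord_max l.
have cardE w : \sum_l \1_(F l) w = #|last_queries A w|%:R :> R.
  rewrite -sum1_card natr_sum [RHS]big_mkcond/=; apply: eq_bigr => l _.
  rewrite indicE inE /F/=.
  by case: (boolP (_ \in accesses A w)) => h;
    [rewrite mem_set|rewrite memNset//; apply/negP].
pose k : R := n.+1%:R / 5.
pose B := [set w | k <= \sum_l \1_(F l) w]%classic.
have mB : measurable B.
  rewrite -[B]setTI; apply: measurable_fun_le => //.
  by apply: measurable_sum => l; apply: measurable_indic.
(* On [B] the queries alone take time [c1 * d * k], the claimed bound, so [B] lies in the event
   assumed negligible. *)
have PB : P B = 0%E.
  apply/(negligibleP _ mB); apply: negligibleS Pnegl => w; rewrite /B/= cardE => kw.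
  rewrite /last_token_time -[leLHS]addr0 lerD ?other_time_ge0//.
  apply: (@le_trans _ _ (\sum_(l in last_queries A w) c1 * d%:R)).
    rewrite sumr_const -[leRHS]mulr_natr.
    have -> : c1 / 5 * n.+1%:R * d%:R = c1 * d%:R * k by rewrite /k; ring.
    by rewrite ler_wpM2l// mulr_ge0// ltW.
  by apply: ler_sum => l _; have /andP[] := tA w (Stream 0 0 0) l.
(* Fewer than [k] queries occur off [B], and at most [n + 1] on it. *)
have : (\sum_l P (F l) <= k%:E + n.+1%:R%:E * P B)%E.
  apply: sum_probability_le => // [|w]; first by rewrite /k divr_ge0.
  rewrite (@indicE _ _ B); have [kw|kw] := leP k (\sum_l \1_(F l) w).
    rewrite mem_set// mulr1 cardE -[leLHS]add0r lerD//; first by rewrite /k divr_ge0.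
    by rewrite ler_nat -[X in (_ <= X)%N]card_ord max_card.
  by rewrite memNset ?mulr0 ?addr0 ?ltW//=; apply/negP; rewrite -ltNge.
rewrite PB mule0 adde0; apply/negP; rewrite -ltNge.
(* The last index is split off and its probability bounded below by 0; the other [n] contribute 4/5
   each. *)
rewrite big_ord_recr/=.
apply: (@lt_le_trans _ _ (\sum_(l < n) (4 / 5)%:E)%E).
  rewrite sumEFin lte_fin sumr_const card_ord -[ltRHS]mulr_natr /k -natr1.
  have : 1 <= n%:R :> R by rewrite ler1n.
  lra.
rewrite -[leLHS]adde0 leeD//; apply: lee_sum => l _.
apply: probability_last_query_ge cA _ => //.
by rewrite -val_eqE/= ltn_eqF.
Qed.
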